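(* Let $d\ge 1$ be an integer, and let $\mu$ and $\mu_n$, $n\in\mathbb{N}$, be probability measures on $(\mathbb{R}^d,\mathcal{B}(\mathbb{R}^d))$ with corresponding characteristic functions $\chi$ and $\chi_n$, $n\in\mathbb{N}$, respectively. Then the following are equivalent: (i) The sequence $(\mu_n)_{n\in\mathbb{N}}$ converges weakly to $\mu$. (ii) $\lim_{n\to\infty}\chi_n(t)=\chi(t)$ for all $t\in\mathbb{R}^d$.
   Context: $\mathcal{B}(\mathbb{R}^d)$ denotes the Borel $\sigma$-field of $\mathbb{R}^d$, and $\langle\cdot,\cdot\rangle$ denotes the standard Euclidean inner product on $\mathbb{R}^d$. The characteristic function of a probability measure $\nu$ on $(\mathbb{R}^d,\mathcal{B}(\mathbb{R}^d))$ is the function $\mathbb{R}^d\to\mathbb{C}$, $t\mapsto\int_{\mathbb{R}^d}\exp(i\langle t,x\rangle)\,d\nu(x)$. Weak convergence of $(\mu_n)_{n\in\mathbb{N}}$ to $\mu$ means that $\int f\,d\mu_n\to\int f\,d\mu$ as $n\to\infty$ for every bounded continuous function $f:\mathbb{R}^d\to\mathbb{R}$. *)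

(* Defs.v *)
From mathcomp Require Import all_boot all_order all_algebra.
From mathcomp.real_closed Require Import complex.
From mathcomp Require Import all_classical all_reals all_analysis.

Set Implicit Arguments.
Unset Strict Implicit.
Unset Printing Implicit Defensive.

Import Order.TTheory GRing.Theory Num.Theory.
Import numFieldTopology.Exports numFieldNormedType.Exports.

Local Open Scope classical_set_scope.
Local Open Scope complex_scope.
Local Open Scope ring_scope.

(* 'rV[R]_d with its Borel sigma-algebra. The topology of 'rV[R]_d is the
   product topology, i.e. the Euclidean one. *)
Definition borelRd (R : realType) (d : nat) :=
  g_sigma_algebraType (@open 'rV[R]_d).

Definition dotprod (R : realType) (d : nat) (u v : 'rV[R]_d) : R :=
  \sum_(i < d) u 0 i * v 0 i.

(* exp (x + i y) = exp x * (cos y + i sin y) *)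
Definition expC (R : realType) (z : R[i]) : R[i] :=
  (expR (complex.Re z))%:C * (cos (complex.Im z) +i* sin (complex.Im z)).

Definition Cintegral (dT : measure_display) (T : measurableType dT)
    (R : realType) (mu : {measure set T -> \bar R}) (g : T -> R[i]) : R[i] :=
  (\int[mu]_x complex.Re (g x)) +i* (\int[mu]_x complex.Im (g x)).

(* The codomain is R[i]^o, convertible to R[i], because the topology given by
   the modulus is inferred only on the former. *)
Definition char_fun (R : realType) (d : nat)
    (nu : probability (borelRd R d) R) (t : 'rV[R]_d) : R[i]^o :=
  Cintegral nu (fun x => expC ('i%C * (dotprod t x)%:C)).

Definition weakly_converges (R : realType) (d : nat)
    (mu_ : nat -> probability (borelRd R d) R)
    (mu : probability (borelRd R d) R) : Prop :=
  forall f : 'rV[R]_d -> R, continuous f -> bounded_fun f ->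
    \int[mu_ n]_x f x @[n --> \oo] --> \int[mu]_x f x.

(* Main.v *)
Require Import Defs.
From mathcomp Require Import all_boot all_order all_algebra.
From mathcomp.real_closed Require Import complex.
From mathcomp Require Import all_classical all_reals all_analysis.
From mathcomp Require Import measurable_realfun.
From mathcomp Require Import ring lra.
Import Order.TTheory GRing.Theory Num.Theory.
Import numFieldTopology.Exports numFieldNormedType.Exports.
Local Open Scope classical_set_scope.
Local Open Scope ring_scope.

Set Implicit Arguments.
Unset Strict Implicit.
Unset Printing Implicit Defensive.

(** The real and imaginary parts of a characteristic function at [t] are the
    integrals of [cos <t,x>] and [sin <t,x>], which are bounded and continuous
    in [x]; so weak convergence implies pointwise convergence of the
    characteristic functions.

    Conversely, pointwise convergence of the characteristic functions says that
    [\int T d mu_n --> \int T d mu] for every trigonometric polynomial [T]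
    ([trig_poly_integral_cvg]). Two facts extend this to a bounded continuous
    function [f] with bound [B].

    - Approximation on a box ([trig_poly_approx]). The map sending [x_i] to
      [(1 + sin (x_i / 2L)) / 2] is a homeomorphism of the box [|x_i| <= L] onto
      a compact part of the open unit cube, with inverse given by the arcsine,
      and it turns polynomials into trigonometric polynomials. The multivariate
      Bernstein polynomials of [f] read in these coordinates therefore
      approximate [f] uniformly on the box. Since the Bernstein weights are
      nonnegative with sum 1, the approximant [T] still satisfies [|T| <= B] on
      the whole space.

    - Control of the tails. Put [s y = \int_0^1 (1 - cos (t y)) dt], which is
      nonnegative, and at least 1/2 as soon as [|y| >= 2]. Outside the box
      [|x_i| <= 2 / a] one of the [s (a x_i)] is thus at least 1/2, so that
      everywhere [|f - T| <= e + 4 B \sum_i s (a x_i)] ([integral_approx]). By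
      Tonelli's theorem the integral of [s (a x_i)] is an average over [t] in
      [[0, 1]] of integrals of [1 - cos (t a x_i)], that is, of values of the
      characteristic function; by dominated convergence it converges along
      [mu_n] to its value for [mu] ([tail_mass_cvg]), and the latter tends to 0
      with [a] ([tail_mass_scale_cvg0]).

    Choosing first [a], then [T], then [n] gives the weak convergence. *)

(** * Bernstein polynomials in one variable *)

Definition bernstein (R : realType) (N k : nat) (u : R) : R :=
  'C(N, k)%:R * u ^+ k * (1 - u) ^+ (N - k).

Lemma bernstein_ge0 (R : realType) (N k : nat) (u : R) :
  0 <= u <= 1 -> 0 <= bernstein N k u.
Proof.
move=> /andP[u0 u1]; rewrite /bernstein !mulr_ge0 ?exprn_ge0 ?subr_ge0//.
Qed.

(** Conditioning on the last of [N + 1] coin tosses: this recursion turns the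
    computation of binomial moments into inductions on [N]. *)
Lemma sum_bernsteinS (R : realType) (N : nat) (u : R) (g : nat -> R) :
  \sum_(k < N.+2) bernstein N.+1 k u * g k =
  u * \sum_(k < N.+1) bernstein N k u * g k.+1 +
  (1 - u) * \sum_(k < N.+1) bernstein N k u * g k.
Proof.
have pascal k : (k <= N)%N -> bernstein N.+1 k.+1 u =
    u * bernstein N k u + (1 - u) * bernstein N k.+1 u.
  move=> kN; rewrite /bernstein binS natrD subSS exprS.
  have [->|kltN] := eqVneq k N.
    by rewrite bin_small// binn subnn; ring.
  have -> : (N - k = (N - k.+1).+1)%N by rewrite subnSK// ltn_neqAle kltN.
  by rewrite exprS; ring.
have first_node : bernstein N.+1 0 u = (1 - u) * bernstein N 0 u.
  by rewrite /bernstein !bin0 !subn0 exprS; ring.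
have bernstein_out : bernstein N N.+1 u = 0.
  by rewrite /bernstein bin_small// !mul0r.
have extend : \sum_(k < N.+1) bernstein N k u * g k =
    \sum_(k < N.+2) bernstein N k u * g k.
  by rewrite [RHS]big_ord_recr/= bernstein_out mul0r addr0.
rewrite extend !(big_ord_recl N.+1)/= first_node mulrDr addrCA -mulrA.
congr (_ + _); rewrite !mulr_sumr -big_split/=; apply: eq_bigr => k _.
by rewrite pascal ?leq_ord// mulrDl !mulrA.
Qed.

Lemma sum_bernstein (R : realType) (N : nat) (u : R) :
  \sum_(k < N.+1) bernstein N k u = 1.
Proof.
elim: N => [|N IH].
  by rewrite big_ord1 /bernstein bin0 !expr0 !mulr1.
transitivity (\sum_(k < N.+2) bernstein N.+1 k u * (fun=> 1) (k : nat)).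
  by apply: eq_bigr => k _; rewrite mulr1.
rewrite (sum_bernsteinS _ _ (fun=> 1)); under eq_bigr do rewrite mulr1.
by rewrite IH; ring.
Qed.

(** The moment is taken about an arbitrary point [c] because the recursion
    replaces [c] by [c - 1]. *)
Lemma bernstein_moment2 (R : realType) (N : nat) (u c : R) :
  \sum_(k < N.+1) bernstein N k u * (k%:R - c) ^+ 2 =
  (N%:R * u - c) ^+ 2 + N%:R * u * (1 - u).
Proof.
elim: N c => [|N IH] c.
  by rewrite big_ord1 /bernstein bin0 /=; ring.
rewrite (sum_bernsteinS _ _ (fun k => (k%:R - c) ^+ 2)) IH.
under eq_bigr => k _.
  have -> : k.+1%:R - c = k%:R - (c - 1) by rewrite -natr1; ring.
  over.
by rewrite IH -natr1; ring.
Qed.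

Lemma bernstein_variance (R : realType) (N : nat) (u : R) : (0 < N)%N ->
  \sum_(k < N.+1) bernstein N k u * (k%:R / N%:R - u) ^+ 2 =
  u * (1 - u) / N%:R.
Proof.
move=> N0; have Nn0 : N%:R != 0 :> R by rewrite pnatr_eq0 -lt0n.
transitivity ((\sum_(k < N.+1) bernstein N k u * (k%:R - N%:R * u) ^+ 2)
              / N%:R ^+ 2).
  by rewrite mulr_suml; apply: eq_bigr => k _; field.
by rewrite bernstein_moment2; field.
Qed.

(** * Bernstein approximation on the unit cube *)

Definition sqdist (R : realType) (d : nat) (u v : 'rV[R]_d) : R :=
  \sum_(j < d) (u 0 j - v 0 j) ^+ 2.

Definition bernstein_weight (R : realType) (d N : nat)
    (k : {ffun 'I_d -> 'I_N.+1}) (u : 'rV[R]_d) : R :=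
  \prod_(i < d) bernstein N (k i) (u 0 i).

Definition bernstein_node (R : realType) (d N : nat)
    (k : {ffun 'I_d -> 'I_N.+1}) : 'rV[R]_d :=
  \row_i ((k i)%:R / N%:R).

Lemma bernstein_weight_ge0 (R : realType) (d N : nat)
    (k : {ffun 'I_d -> 'I_N.+1}) (u : 'rV[R]_d) :
  (forall i, 0 <= u 0 i <= 1) -> 0 <= bernstein_weight k u.
Proof. by move=> u01; apply: prodr_ge0 => i _; exact: bernstein_ge0. Qed.

Lemma sum_bernstein_weight (R : realType) (d N : nat) (u : 'rV[R]_d) :
  \sum_(k : {ffun 'I_d -> 'I_N.+1}) bernstein_weight k u = 1.
Proof.
rewrite -(bigA_distr_bigA (fun i (j : 'I_N.+1) => bernstein N j (u 0 i)))/=.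
by under eq_bigr do rewrite sum_bernstein; rewrite big1.
Qed.

(** The weights are the law of a vector of independent binomial frequencies, so
    the expected squared distance to the mean is a sum of [d] variances. *)
Lemma bernstein_weight_variance (R : realType) (d N : nat) (u : 'rV[R]_d) :
  (0 < N)%N -> (forall i, 0 <= u 0 i <= 1) ->
  \sum_(k : {ffun 'I_d -> 'I_N.+1})
    bernstein_weight k u * sqdist (bernstein_node R k) u <= d%:R / N%:R.
Proof.
move=> N0 u01.
under eq_bigr do rewrite /sqdist mulr_sumr.
rewrite exchange_big/=.
have -> : d%:R / N%:R = \sum_(j < d) N%:R^-1 :> R.
  by rewrite sumr_const card_ord mulr_natl.
apply: ler_sum => j _.
have -> : \sum_(k : {ffun 'I_d -> 'I_N.+1})
    bernstein_weight k u * (bernstein_node R k 0 j - u 0 j) ^+ 2 =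
  \prod_(i < d) \sum_(m < N.+1) bernstein N m (u 0 i) *
    (if i == j then (m%:R / N%:R - u 0 i) ^+ 2 else 1).
  rewrite bigA_distr_bigA/=; apply: eq_bigr => k _.
  rewrite big_split/= -/(bernstein_weight k u); congr (_ * _).
  by rewrite -big_mkcond/= big_pred1_eq mxE.
rewrite (bigD1 j)//= [X in _ * X]big1 ?mulr1; last first.
  move=> i ij; rewrite (negbTE ij); under eq_bigr do rewrite mulr1.
  exact: sum_bernstein.
rewrite eqxx bernstein_variance// ler_piMl ?invr_ge0//.
by have /andP[? ?] := u01 j; nra.
Qed.

Definition bernstein_op (R : realType) (d N : nat) (G : 'rV[R]_d -> R)
    (u : 'rV[R]_d) : R :=
  \sum_(k : {ffun 'I_d -> 'I_N.+1})
    bernstein_weight k u * G (bernstein_node R k).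

Lemma bernstein_op_bound (R : realType) (d N : nat) (G : 'rV[R]_d -> R)
    (B : R) (u : 'rV[R]_d) :
  (forall v, `|G v| <= B) -> (forall i, 0 <= u 0 i <= 1) ->
  `|bernstein_op N G u| <= B.
Proof.
move=> GB u01; apply: le_trans (ler_norm_sum _ _ _) _.
rewrite -[leRHS]mul1r -(sum_bernstein_weight N u) mulr_suml.
apply: ler_sum => k _; rewrite normrM ger0_norm ?bernstein_weight_ge0//.
by rewrite ler_wpM2l// bernstein_weight_ge0.
Qed.

Lemma coord_far_sqdist (R : realType) (d : nat) (u v : 'rV[R]_d) (e : R) :
  0 < e -> ~ ball u e v -> e ^+ 2 <= sqdist u v.
Proof.
move=> e0 nb.
have [j ej] : exists j, e <= `|u 0 j - v 0 j|.
  apply: contrapT => /forallNP h; apply: nb; split => // i j.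
  by rewrite (ord1 i) /ball/= ltNge; apply/negP; exact: h.
rewrite /sqdist (bigD1 j)//= -[leLHS]addr0 lerD ?sumr_ge0//.
  by rewrite -[leRHS]real_normK ?num_real// lerXn2r ?nnegrE// ltW.
by move=> i _; rewrite sqr_ge0.
Qed.

(** Uniform continuity on the cube in the form that suits Bernstein's argument:
    where the modulus of continuity gives nothing, the trivial bound [2 B] is
    dominated by a multiple of the squared distance. By compactness one multiple
    serves the whole cube. *)
Lemma continuous_le_sqdist (R : realType) (d : nat) (G : 'rV[R]_d -> R)
    (B e : R) :
  continuous G -> (forall v, `|G v| <= B) -> 0 < e ->
  exists2 C : R, 0 <= C & forall u v : 'rV[R]_d, (forall i, 0 <= u 0 i <= 1) ->
    `|G v - G u| <= e + C * sqdist v u.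
Proof.
move=> cG GB e0.
pose K := [set u : 'rV[R]_d | forall i, `[0, 1]%classic (u ord0 i)].
have /compact_near_coveringP cK : compact K.
  apply: (@rV_compact R d (fun=> `[0, 1]%classic)) => _; exact: segment_compact.
pose P (C : R) (u : 'rV[R]_d) := forall v, `|G v - G u| <= e + C * sqdist v u.
have sq0 (u v : 'rV[R]_d) : 0 <= sqdist u v.
  by rewrite sumr_ge0// => i _; rewrite sqr_ge0.
have B0 : 0 <= B by exact: le_trans (normr_ge0 _) (GB 0).
suff [C [_ CP]] : \forall C \near +oo, K `<=` P C.
  exists (Num.max 0 (C + 1)); first by rewrite le_max lexx.
  move=> u v u01; have Cu : P (C + 1) u.
    by apply: CP; rewrite ?ltrDl// => i; rewrite /= in_itv/= u01.
  apply: le_trans (Cu v) _; rewrite lerD2l ler_wpM2r// le_max lexx orbT//.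
apply: cK => u Ku.
have e20 : 0 < e / 2 by rewrite divr_gt0.
have /nbhs_ballP[r /= r0 ru] : nbhs u [set v | `|G u - G v| < e / 2].
  by have /cvgrPdist_lt/(_ _ e20) := cG u.
exists (ball u (r / 2), [set C | 2 * B / (r / 2) ^+ 2 <= C]).
  split => /=; first by apply: nbhsx_ballx; rewrite divr_gt0.
  by apply: nbhs_pinfty_ge; rewrite num_real.
move=> [w C] /= [uw hC] v.
(* [r / 2] is what remains of the radius of continuity at [u] around [w]. *)
have [wv|wv] := pselect (ball w (r / 2) v).
  have uv : `|G u - G v| < e / 2.
    by apply: ru; rewrite [r]splitr; exact: ball_triangle wv.
  have uw' : `|G u - G w| < e / 2.
    by apply: ru; apply: le_ball uw; lra.
  have C0 : 0 <= C by apply: le_trans hC; rewrite divr_ge0 ?sqr_ge0 ?mulr_ge0.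
  have -> : G v - G w = (G u - G w) - (G u - G v) by ring.
  apply: le_trans (ler_normB _ _) _.
  have := mulr_ge0 C0 (sq0 v w); lra.
have {}wv : (r / 2) ^+ 2 <= sqdist v w.
  have -> : sqdist v w = sqdist w v.
    by apply: eq_bigr => i _; rewrite -sqrrN opprB.
  by apply: coord_far_sqdist => //; rewrite divr_gt0.
have r20 : 0 < (r / 2) ^+ 2 by rewrite exprn_gt0// divr_gt0.
apply: le_trans (ler_normB _ _) _.
have : 2 * B <= C * sqdist v w.
  apply: (@le_trans _ _ (2 * B / (r / 2) ^+ 2 * (r / 2) ^+ 2)).
    by rewrite divfK// gt_eqF.
  apply: ler_pM => //; first by rewrite divr_ge0 ?(ltW r20)// mulr_ge0.
  exact: ltW r20.
have := GB v; have := GB w; lra.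
Qed.

(** Averaging the bound of [continuous_le_sqdist] against the weights leaves
    [e / 2] plus [C] times the variance, which is [O(1 / N)]. *)
Lemma bernstein_op_cvg (R : realType) (d : nat) (G : 'rV[R]_d -> R) (B e : R) :
  continuous G -> (forall v, `|G v| <= B) -> 0 < e ->
  exists N, forall u : 'rV[R]_d, (forall i, 0 <= u 0 i <= 1) ->
    `|bernstein_op N G u - G u| <= e.
Proof.
move=> cG GB e0; have e20 : 0 < e / 2 by rewrite divr_gt0.
have [C C0 hC] := continuous_le_sqdist cG GB e20.
pose N := (Num.truncn (C * d%:R / (e / 2))).+1.
have Nbig : C * (d%:R / N%:R) <= e / 2.
  by rewrite mulrA ler_pdivrMr ?ltr0n// [leRHS]mulrC -ler_pdivrMr// ltW//
    truncnS_gt.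
exists N => u u01.
have -> : bernstein_op N G u - G u = \sum_(k : {ffun 'I_d -> 'I_N.+1})
    bernstein_weight k u * (G (bernstein_node R k) - G u).
  under [RHS]eq_bigr do rewrite mulrBr.
  by rewrite sumrB -mulr_suml sum_bernstein_weight mul1r.
apply: le_trans (ler_norm_sum _ _ _) _.
apply: (@le_trans _ _ (\sum_(k : {ffun 'I_d -> 'I_N.+1})
    (bernstein_weight k u * (e / 2) +
     C * (bernstein_weight k u * sqdist (bernstein_node R k) u)))).
  apply: ler_sum => k _; have w0 := bernstein_weight_ge0 k u01.
  by rewrite normrM (ger0_norm w0) (mulrCA C) -mulrDr ler_wpM2l// hC.
rewrite big_split/= -mulr_suml sum_bernstein_weight mul1r -mulr_sumr.
have := ler_wpM2l C0 (bernstein_weight_variance (isT : 0 < N)%N u01).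
move/le_trans => /(_ _ Nbig); lra.
Qed.

(** * Trigonometric polynomials *)

Lemma dotprodDl (R : realType) (d : nat) (s t x : 'rV[R]_d) :
  dotprod (s + t) x = dotprod s x + dotprod t x.
Proof.
by rewrite /dotprod -big_split/=; apply: eq_bigr => i _; rewrite mxE mulrDl.
Qed.

Lemma dotprodNl (R : realType) (d : nat) (t x : 'rV[R]_d) :
  dotprod (- t) x = - dotprod t x.
Proof. by rewrite /dotprod -sumrN; apply: eq_bigr => i _; rewrite mxE mulNr. Qed.

Lemma dotprod0l (R : realType) (d : nat) (x : 'rV[R]_d) : dotprod 0 x = 0.
Proof. by rewrite /dotprod big1// => i _; rewrite mxE mul0r. Qed.

Lemma dotprod_delta (R : realType) (d : nat) (i : 'I_d) (a : R) (x : 'rV[R]_d) :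
  dotprod (a *: delta_mx 0 i) x = a * x 0 i.
Proof.
rewrite /dotprod (bigD1 i)//= big1 ?addr0.
  by rewrite !mxE !eqxx mulr1.
by move=> j /negbTE ji; rewrite !mxE ji andbF mulr0 mul0r.
Qed.

Lemma continuous_dotprod (R : realType) (d : nat) (t : 'rV[R]_d) :
  continuous (dotprod t).
Proof.
move=> x; apply: (@cvg_big R _ +%R 0 xpredT _ _ (nbhs x)) => [|i _].
  exact: add_continuous.
by apply: cvgM; [exact: cvg_cst|exact: coord_continuous].
Qed.

(** Products are absent on purpose: an integral is linear but not multiplicative,
    so statements about integrals go by induction over these four cases, while
    closure under products is a theorem. *)
Inductive trig_poly (R : realType) (d : nat) : ('rV[R]_d -> R) -> Prop :=
| trig_cos t : trig_poly (fun x => cos (dotprod t x))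
| trig_sin t : trig_poly (fun x => sin (dotprod t x))
| trig_add f g : trig_poly f -> trig_poly g -> trig_poly (fun x => f x + g x)
| trig_scale a f : trig_poly f -> trig_poly (fun x => a * f x).

Lemma trig_poly_cst (R : realType) (d : nat) (a : R) :
  trig_poly (fun _ : 'rV[R]_d => a).
Proof.
rewrite (_ : (fun=> a) = fun x : 'rV[R]_d => a * cos (dotprod 0 x)).
  exact/trig_scale/trig_cos.
by apply/funext => x; rewrite dotprod0l cos0 mulr1.
Qed.

(** The product formulas of trigonometry, extended bilinearly. *)
Lemma trig_poly_mul (R : realType) (d : nat) (f g : 'rV[R]_d -> R) :
  trig_poly f -> trig_poly g -> trig_poly (fun x => f x * g x).
Proof.
move=> tf; move: g; elim: tf => {f}.
- move=> s g; elim=> {g}.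
  + move=> t; rewrite (_ : (fun x => _) = fun x : 'rV[R]_d =>
        2^-1 * (cos (dotprod (s + t) x) + cos (dotprod (s - t) x))).
      by apply/trig_scale/trig_add; exact: trig_cos.
    by apply/funext => x; rewrite !dotprodDl dotprodNl cosB cosD; field.
  + move=> t; rewrite (_ : (fun x => _) = fun x : 'rV[R]_d =>
        2^-1 * (sin (dotprod (t + s) x) + sin (dotprod (t - s) x))).
      by apply/trig_scale/trig_add; exact: trig_sin.
    by apply/funext => x; rewrite !dotprodDl dotprodNl sinB sinD; field.
  + move=> g h _ IHg _ IHh; rewrite (_ : (fun x => _) = fun x : 'rV[R]_d =>
        cos (dotprod s x) * g x + cos (dotprod s x) * h x).
      exact: trig_add.
    by apply/funext => x; rewrite mulrDr.
  + move=> a g _ IH; rewrite (_ : (fun x => _) = fun x : 'rV[R]_d =>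
        a * (cos (dotprod s x) * g x)); first exact: trig_scale.
    by apply/funext => x; rewrite mulrCA.
- move=> s g; elim=> {g}.
  + move=> t; rewrite (_ : (fun x => _) = fun x : 'rV[R]_d =>
        2^-1 * (sin (dotprod (s + t) x) + sin (dotprod (s - t) x))).
      by apply/trig_scale/trig_add; exact: trig_sin.
    by apply/funext => x; rewrite !dotprodDl dotprodNl sinB sinD; field.
  + move=> t; rewrite (_ : (fun x => _) = fun x : 'rV[R]_d =>
        2^-1 * (cos (dotprod (s - t) x) + -1 * cos (dotprod (s + t) x))).
      by apply/trig_scale/trig_add; [|apply: trig_scale]; exact: trig_cos.
    by apply/funext => x; rewrite !dotprodDl dotprodNl cosB cosD; field.
  + move=> g h _ IHg _ IHh; rewrite (_ : (fun x => _) = fun x : 'rV[R]_d =>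
        sin (dotprod s x) * g x + sin (dotprod s x) * h x).
      exact: trig_add.
    by apply/funext => x; rewrite mulrDr.
  + move=> a g _ IH; rewrite (_ : (fun x => _) = fun x : 'rV[R]_d =>
        a * (sin (dotprod s x) * g x)); first exact: trig_scale.
    by apply/funext => x; rewrite mulrCA.
- move=> f h _ IHf _ IHh g tg; rewrite (_ : (fun x => _) =
      fun x : 'rV[R]_d => f x * g x + h x * g x).
    by apply: trig_add; [exact: IHf|exact: IHh].
  by apply/funext => x; rewrite mulrDl.
- move=> a f _ IH g tg; rewrite (_ : (fun x => _) =
      fun x : 'rV[R]_d => a * (f x * g x)); first exact/trig_scale/IH.
  by apply/funext => x; rewrite mulrA.
Qed.

Lemma trig_poly_exp (R : realType) (d n : nat) (f : 'rV[R]_d -> R) :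
  trig_poly f -> trig_poly (fun x => f x ^+ n).
Proof.
move=> tf; elim: n => [|n IH]; first exact: trig_poly_cst.
rewrite (_ : (fun x => _) = fun x => f x * f x ^+ n).
  exact: trig_poly_mul.
by apply/funext => x; rewrite exprS.
Qed.

Lemma trig_poly_sum (R : realType) (d : nat) (I : Type) (r : seq I)
    (F : I -> 'rV[R]_d -> R) :
  (forall i, trig_poly (F i)) -> trig_poly (fun x => \sum_(i <- r) F i x).
Proof.
move=> tF; elim: r => [|i r IH].
  by under eq_fun do rewrite big_nil; exact: trig_poly_cst.
by under eq_fun do rewrite big_cons; exact: trig_add.
Qed.

Lemma trig_poly_prod (R : realType) (d : nat) (I : Type) (r : seq I)
    (F : I -> 'rV[R]_d -> R) :
  (forall i, trig_poly (F i)) -> trig_poly (fun x => \prod_(i <- r) F i x).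
Proof.
move=> tF; elim: r => [|i r IH].
  by under eq_fun do rewrite big_nil; exact: trig_poly_cst.
by under eq_fun do rewrite big_cons; exact: trig_poly_mul.
Qed.

Lemma trig_poly_continuous (R : realType) (d : nat) (f : 'rV[R]_d -> R) :
  trig_poly f -> continuous f.
Proof.
elim=> {f} [t|t|f g _ cf _ cg|a f _ cf] x.
- by apply: continuous_comp; [exact: continuous_dotprod|exact: continuous_cos].
- by apply: continuous_comp; [exact: continuous_dotprod|exact: continuous_sin].
- exact: (continuousD (cf x) (cg x)).
- by apply: continuousM; [exact: cst_continuous|exact: cf].
Qed.

Lemma trig_poly_bounded (R : realType) (d : nat) (f : 'rV[R]_d -> R) :
  trig_poly f -> exists B, forall x, `|f x| <= B.
Proof.
elim=> {f} [t|t|f g _ [A fA] _ [B gB]|a f _ [B fB]].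
- by exists 1 => x; exact: cos_max.
- by exists 1 => x; exact: sin_max.
- by exists (A + B) => x; apply: le_trans (ler_normD _ _) _; exact: lerD.
- by exists (`|a| * B) => x; rewrite normrM ler_wpM2l.
Qed.

Definition sin_coord (R : realType) (d : nat) (L : R) (x : 'rV[R]_d) : 'rV[R]_d :=
  \row_i ((1 + sin (L^-1 * x 0 i)) / 2).

(** The arcsine has a meaning on [[-1, 1]] only; clamping at [sin (1 / 2)] makes
    it continuous on the whole line without changing it at the sines of the
    angles in [[-1/2, 1/2]]. *)
Definition asin_clamp (R : realType) (w : R) : R :=
  asin (Num.max (- sin 2^-1) (Num.min (sin 2^-1) w)).

Definition asin_coord (R : realType) (d : nat) (L : R) (v : 'rV[R]_d)
    : 'rV[R]_d :=
  \row_i (L * asin_clamp (2 * v 0 i - 1)).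

Lemma sin_half_itv (R : realType) : 0 < sin (2^-1 : R) < 1.
Proof.
have p := pihalf_ge1 R.
rewrite sin_gt0_pihalf/=; last lra.
rewrite -[ltRHS](@sin_pihalf R) ltr_sin ?in_itv/=; lra.
Qed.

Lemma continuous_asin_clamp (R : realType) : continuous (@asin_clamp R).
Proof.
move=> w; have /andP[s0 s1] := sin_half_itv R; apply: continuous_comp.
  apply: (@continuous_max R R (cst (- sin 2^-1)) (fun w => Num.min (sin 2^-1) w)).
    exact: cst_continuous.
  apply: (@continuous_min R R (cst (sin 2^-1)) id) => //; exact: cst_continuous.
apply: continuous_asin; rewrite lt_max gt_max gt_min s1/=; lra.
Qed.

Lemma asin_clampK (R : realType) (y : R) : `|y| <= 2^-1 -> asin_clamp (sin y) = y.
Proof.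
rewrite ler_norml => /andP[ym yM]; have p := pihalf_ge1 R.
have sinm : - sin 2^-1 <= sin y.
  by rewrite -sinN leNgt ltr_sin ?in_itv/= -?leNgt; lra.
have sinM : sin y <= sin 2^-1.
  by rewrite leNgt ltr_sin ?in_itv/= -?leNgt; lra.
rewrite /asin_clamp min_r// max_r// sinK// in_itv/=; lra.
Qed.

Lemma continuous_row (R : realType) (d : nat) (h : R -> R) :
  continuous h -> continuous (fun v : 'rV[R]_d => \row_i h (v 0 i) : 'rV[R]_d).
Proof.
move=> ch v.
have FF : Filter (nbhs v) by exact: nbhs_filter.
apply/(cvg_ballP _ (FF := fmap_filter _ FF)) => e e0.
have : nbhs v
    [set w : 'rV[R]_d | forall j : 'I_d, ball (h (v 0 j)) e (h (w 0 j))].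
  apply: (filter_forall FF) => j.
  have : (fun w : 'rV[R]_d => h (w 0 j)) w @[w --> v] --> h (v 0 j).
    by apply: (@continuous_comp _ _ _ (fun w : 'rV[R]_d => w 0 j) h);
      [exact: coord_continuous|exact: ch].
  by move/cvg_ballP; exact.
by apply: filterS => w hw; split => // i j; rewrite !mxE; exact: hw.
Qed.

(** The Bernstein approximation of [f] in the coordinates [sin_coord (2 * L)].
    The factor 2 keeps the angles [x_i / 2L] in [[-1/2, 1/2]], where
    [asin_coord] inverts [sin_coord] exactly. The bound [B] holds off the box
    too, because [sin_coord] takes all its values in the cube. *)
Lemma trig_poly_approx (R : realType) (d : nat) (f : 'rV[R]_d -> R) (B e L : R) :
  continuous f -> (forall x, `|f x| <= B) -> 0 < e -> 0 < L ->
  exists T : 'rV[R]_d -> R, [/\ trig_poly T, forall x, `|T x| <= B &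
    forall x : 'rV[R]_d, (forall i, `|x 0 i| <= L) -> `|T x - f x| <= e].
Proof.
move=> cf fB e0 L0.
pose G := f \o asin_coord (2 * L).
have cG : continuous G.
  move=> v; apply: continuous_comp; last exact: cf.
  apply: (@continuous_row R d (fun w => 2 * L * asin_clamp (2 * w - 1))) => w.
  apply: cvgM; first exact: cvg_cst.
  apply: (@continuous_comp _ _ _ (fun w : R => 2 * w - 1));
    last exact: continuous_asin_clamp.
  by apply: cvgB; [apply: cvgM; [exact: cvg_cst|exact: cvg_id]|exact: cvg_cst].
have GB v : `|G v| <= B by exact: fB.
have [N hN] := bernstein_op_cvg cG GB e0.
have coord01 (x : 'rV[R]_d) i : 0 <= sin_coord (2 * L) x 0 i <= 1.
  rewrite mxE; have := sin_geN1 ((2 * L)^-1 * x 0 i).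
  have := sin_le1 ((2 * L)^-1 * x 0 i); lra.
exists (fun x => bernstein_op N G (sin_coord (2 * L) x)); split.
- apply: trig_poly_sum => k.
  apply: trig_poly_mul; last exact: trig_poly_cst.
  apply: trig_poly_prod => i; rewrite /bernstein.
  have tsin : trig_poly (fun x => sin_coord (2 * L) x 0 i).
    rewrite (_ : (fun x => _) = fun x : 'rV[R]_d =>
      2^-1 * (1 + sin (dotprod ((2 * L)^-1 *: delta_mx 0 i) x))).
      exact/trig_scale/trig_add/trig_sin/trig_poly_cst.
    by apply/funext => x; rewrite mxE dotprod_delta mulrC.
  apply: trig_poly_mul.
    by apply: trig_poly_mul; [exact: trig_poly_cst|exact: trig_poly_exp].
  apply/trig_poly_exp/trig_add; first exact: trig_poly_cst.
  rewrite (_ : (fun x => _) = fun x : 'rV[R]_d => -1 * sin_coord (2 * L) x 0 i).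
    exact: trig_scale.
  by apply/funext => x; rewrite mulN1r.
- by move=> x; exact: bernstein_op_bound.
- move=> x xL; suff <- : G (sin_coord (2 * L) x) = f x by exact: hN.
  congr f; apply/rowP => i; rewrite !mxE.
  rewrite (_ : 2 * _ - 1 = sin ((2 * L)^-1 * x 0 i)); last by field.
  have small : `|(2 * L)^-1 * x 0 i| <= 2^-1.
    rewrite normrM gtr0_norm ?invr_gt0 ?mulr_gt0// mulrC.
    by rewrite ler_pdivrMr ?mulr_gt0// mulKf.
  by rewrite asin_clampK// mulrA divff ?mul1r// gt_eqF// mulr_gt0.
Qed.

(** * Integrals against probability measures and tail estimates *)

Lemma measurable_continuous_borelRd (R : realType) (d : nat) (f : 'rV[R]_d -> R) :
  continuous f -> measurable_fun [set: borelRd R d] (f : borelRd R d -> R).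
Proof.
move=> /continuousP cf; apply: (measurability _ (RGenOpens.measurableE R)).
move=> _ [_ [a [b ->] <-]]; rewrite setTI; apply: sub_sigma_algebra.
exact/cf/interval_open.
Qed.

Lemma probability_integrable_bounded dT (T : measurableType dT) (R : realType)
    (P : probability T R) (f : T -> R) (B : R) :
  measurable_fun setT f -> (forall x, `|f x| <= B) ->
  P.-integrable setT (EFin \o f).
Proof.
move=> mf fB; apply: measurable_bounded_integrable => //.
  by rewrite (le_lt_trans (probability_le1 P measurableT))// ltry.
exists B; split; first by rewrite num_real.
by move=> M BM x _ /=; exact: le_trans (fB x) (ltW BM).
Qed.

Lemma Rintegral_probability_cst dT (T : measurableType dT) (R : realType)
    (P : probability T R) (r : R) : \int[P]_x r = r.
Proof.
rewrite Rintegral_cst//.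
transitivity (r * fine 1); last by rewrite mulr1.
congr (_ * fine _); exact: probability_setT.
Qed.

Lemma normr_Rintegral_le dT (T : measurableType dT) (R : realType)
    (P : probability T R) (f : T -> R) (B : R) :
  measurable_fun setT f -> (forall x, `|f x| <= B) -> `|\int[P]_x f x| <= B.
Proof.
move=> mf fB; have intf := probability_integrable_bounded P mf fB.
apply: le_trans (le_normr_Rintegral _ _) _ => //.
have -> : B = \int[P]_x B.
  by rewrite Rintegral_probability_cst.
apply: le_Rintegral => //; last exact: finite_measure_integrable_cst.
apply: (@probability_integrable_bounded _ _ _ _ _ B).
  exact: measurableT_comp.
by move=> x; rewrite normr_id.
Qed.

(** The integrand of the tail estimate, on the product of the space with the
    parameter interval; integrating it in either order gives the two faces of
    [tail_mass] below. *)
Definition cos_defect (R : realType) (d : nat) (a : R) (i : 'I_d)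
    (z : borelRd R d * measurableTypeR R) : R :=
  1 - cos (z.2 * (a * (z.1 : 'rV[R]_d) 0 i)).

Definition unit_uniform (R : realType) : probability (measurableTypeR R) R :=
  uniform_prob (@ltr01 R).

Lemma cos_defect_itv (R : realType) (y : R) : 0 <= 1 - cos y <= 2.
Proof. by have := cos_geN1 y; have := cos_le1 y; lra. Qed.

Lemma cos_defect_abs (R : realType) (y : R) : `|1 - cos y| <= 2.
Proof. by have /andP[y0 y2] := cos_defect_itv y; rewrite ger0_norm. Qed.

Lemma measurable_cos_defect (R : realType) (d : nat) (a : R) (i : 'I_d) :
  measurable_fun setT (@cos_defect R d a i).
Proof.
apply: measurable_funB => //; apply: measurableT_comp.
  by apply: continuous_measurable_fun; exact: continuous_cos.
apply: measurable_funM => //; apply: measurable_funM => //.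
apply: (@measurableT_comp _ _ _ _ _ _
  (fun x : borelRd R d => (x : 'rV[R]_d) 0 i)) => //.
by apply: measurable_continuous_borelRd; exact: coord_continuous.
Qed.

(** Twice this number bounds the mass that [P] gives to [|x_i| >= 2 / a]. *)
Definition tail_mass (R : realType) (d : nat) (P : probability (borelRd R d) R)
    (a : R) (i : 'I_d) : R :=
  \int[(P \x unit_uniform R)%E]_z cos_defect a i z.

(** This is [1 - sin y / y], extended by 0 at [y = 0]. *)
Definition sinc_defect (R : realType) (y : R) : R :=
  \int[unit_uniform R]_t (1 - cos (t * y)).

Lemma measurable_cos_scale (R : realType) (y : R) :
  measurable_fun setT (fun t : measurableTypeR R => 1 - cos (t * y)).
Proof.
apply: measurable_funB => //; apply: measurableT_comp.
  by apply: continuous_measurable_fun; exact: continuous_cos.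
exact: measurable_funM.
Qed.

Lemma sinc_defect_ge0 (R : realType) (y : R) : 0 <= sinc_defect y.
Proof.
by apply: Rintegral_ge0 => t _; have /andP[] := cos_defect_itv (t * y).
Qed.

Lemma sinc_defect_integralE (R : realType) (y : R) :
  (sinc_defect y)%:E = (\int[unit_uniform R]_t (1 - cos (t * y))%:E)%E.
Proof.
rewrite fineK//; apply: integrable_fin_num => //.
apply: (@probability_integrable_bounded _ _ _ _ _ 2).
  exact: measurable_cos_scale.
by move=> t; exact: cos_defect_abs.
Qed.

Lemma sinc_defectE (R : realType) (y : R) : y != 0 ->
  sinc_defect y = 1 - sin y / y.
Proof.
move=> y0; apply: EFin_inj; rewrite sinc_defect_integralE.
rewrite integral_uniform//; last first.
  by apply/measurable_EFinP; exact: measurable_cos_scale.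
rewrite subr0 invr1 mul1e.
have dF (t : R) :
    is_derive t 1 (fun t => t - y^-1 * sin (t * y) : R) (1 - cos (t * y)).
  by apply: is_derive_eq; rewrite /GRing.scale/=; field.
transitivity ((1 - y^-1 * sin (1 * y))%:E - (0 - y^-1 * sin (0 * y))%:E)%E;
  last first.
  by rewrite mul0r sin0 mul1r -EFinB; congr EFin; field.
apply: (@continuous_FTC2 R (fun t => 1 - cos (t * y))
  (fun t => t - y^-1 * sin (t * y))).
- exact: ltr01.
- apply: continuous_subspaceT => t; apply: cvgB; first exact: cvg_cst.
  apply: continuous_comp; last exact: continuous_cos.
  by apply: cvgM; [exact: cvg_id|exact: cvg_cst].
- have cF : continuous (fun t : R => t - y^-1 * sin (t * y)).
    move=> t; apply/differentiable_continuous/derivable1_diffP.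
    exact: ex_derive.
  split.
  + by move=> t _; exact: ex_derive.
  + by apply: cvg_at_right_filter; exact: cF.
  + by apply: cvg_at_left_filter; exact: cF.
- by move=> t _; rewrite derive1E derive_val.
Qed.

(** The decay of [sin y / y] is what lets an average of characteristic function
    values near 0 detect mass far away; a finite combination of cosines could
    not, being almost periodic. *)
Lemma sinc_defect_ge_half (R : realType) (y : R) : 2 <= `|y| ->
  2^-1 <= sinc_defect y.
Proof.
move=> y2; have y0 : y != 0 by rewrite -normr_gt0; lra.
rewrite sinc_defectE//.
have : `|sin y / y| <= 2^-1.
  rewrite normrM normfV -[leRHS]mul1r ler_pM ?invr_ge0//.
    exact: sin_max.
  by rewrite lef_pV2 ?posrE//; lra.
rewrite ler_norml => /andP[]; lra.
Qed.

Lemma measurable_EFin_cos_defect (R : realType) (d : nat) (a : R) (i : 'I_d) :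
  measurable_fun setT (EFin \o @cos_defect R d a i).
Proof. by apply/measurable_EFinP; exact: measurable_cos_defect. Qed.

Lemma EFin_cos_defect_ge0 (R : realType) (d : nat) (a : R) (i : 'I_d) z :
  (0 <= (EFin \o @cos_defect R d a i) z)%E.
Proof.
rewrite lee_fin.
by have /andP[] := cos_defect_itv (z.2 * (a * (z.1 : 'rV[R]_d) 0 i)).
Qed.

Lemma measurable_sinc_defect_coord (R : realType) (d : nat) (a : R) (i : 'I_d) :
  measurable_fun [set: borelRd R d]
    (fun x : borelRd R d => sinc_defect (a * (x : 'rV[R]_d) 0 i)).
Proof.
apply/measurable_EFinP.
rewrite (_ : _ \o _ = fubini_F (unit_uniform R) (EFin \o @cos_defect R d a i)).
  apply: measurable_fun_fubini_tonelli_F => [|z].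
    exact: measurable_EFin_cos_defect.
  exact: EFin_cos_defect_ge0.
by apply/funext => x; exact: sinc_defect_integralE.
Qed.

Lemma tail_mass_sinc (R : realType) (d : nat) (P : probability (borelRd R d) R)
    (a : R) (i : 'I_d) :
  \int[P]_x sinc_defect (a * (x : 'rV[R]_d) 0 i) = tail_mass P a i.
Proof.
have mc := @measurable_EFin_cos_defect R d a i.
have c0 := @EFin_cos_defect_ge0 R d a i.
rewrite /tail_mass /Rintegral fubini_tonelli1//.
by congr fine; apply: eq_integral => x _; rewrite sinc_defect_integralE.
Qed.

Lemma cos_defect_integral_fst (R : realType) (d : nat)
    (P : probability (borelRd R d) R) (a : R) (i : 'I_d) (t : R) :
  (\int[P]_x (1 - cos (dotprod ((t * a) *: delta_mx 0 i) x)))%:E =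
  (\int[P]_x (@cos_defect R d a i (x, t))%:E)%E.
Proof.
rewrite fineK.
  by apply: eq_integral => x _; rewrite dotprod_delta /cos_defect mulrA.
apply: integrable_fin_num => //.
apply: (@probability_integrable_bounded _ _ _ _ _ 2).
  apply: measurable_funB => //; apply: measurable_continuous_borelRd.
  exact/trig_poly_continuous/trig_cos.
by move=> x; exact: cos_defect_abs.
Qed.

Lemma tail_mass_char (R : realType) (d : nat) (P : probability (borelRd R d) R)
    (a : R) (i : 'I_d) :
  (tail_mass P a i)%:E = (\int[unit_uniform R]_t
    (\int[P]_x (1 - cos (dotprod ((t * a) *: delta_mx 0 i) x)))%:E)%E.
Proof.
have mc := @measurable_EFin_cos_defect R d a i.
have c0 := @EFin_cos_defect_ge0 R d a i.
have ic : (P \x unit_uniform R)%E.-integrable setT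
    (EFin \o @cos_defect R d a i).
  apply: (@probability_integrable_bounded _ _ _ _ _ 2).
    exact: measurable_cos_defect.
  by move=> z; exact: cos_defect_abs.
rewrite /tail_mass fineK; last exact: integrable_fin_num.
rewrite fubini_tonelli2//.
by apply: eq_integral => t _; rewrite cos_defect_integral_fst.
Qed.

Lemma measurable_cos_integral (R : realType) (d : nat)
    (P : probability (borelRd R d) R) (a : R) (i : 'I_d) :
  measurable_fun setT (fun t : measurableTypeR R =>
    \int[P]_x (1 - cos (dotprod ((t * a) *: delta_mx 0 i) x))).
Proof.
apply/measurable_EFinP.
rewrite (_ : _ \o _ = fubini_G P (EFin \o @cos_defect R d a i)).
  apply: measurable_fun_fubini_tonelli_G => [|z].
    exact: measurable_EFin_cos_defect.
  exact: EFin_cos_defect_ge0.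
by apply/funext => t; exact: cos_defect_integral_fst.
Qed.

(** Dominated convergence on the product space: for fixed [(x, t)] the angle
    [t x_i / (n + 1)] tends to 0. *)
Lemma tail_mass_scale_cvg0 (R : realType) (d : nat)
    (P : probability (borelRd R d) R) (i : 'I_d) :
  tail_mass P n.+1%:R^-1 i @[n --> \oo] --> (0 : R).
Proof.
have [|||||_ _ +] := @dominated_convergence _ _ _ (P \x unit_uniform R)%E setT
  measurableT (fun n => EFin \o @cos_defect R d n.+1%:R^-1 i) (cst 0%E)
  (cst 2%:E).
- by move=> n; apply/measurable_EFinP; exact: measurable_cos_defect.
- exact: measurable_cst.
- apply: aeW => /= z _; apply: cvg_EFin; first by near=> n.
  rewrite /cos_defect/= -[X in _ --> X](subrr 1) -[X in _ - X](@cos0 R).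
  apply: cvgB; first exact: cvg_cst.
  apply: continuous_cvg; first exact: continuous_cos.
  rewrite -[X in _ --> X](mulr0 z.2); apply: cvgM; first exact: cvg_cst.
  rewrite -[X in _ --> X](mul0r ((z.1 : 'rV[R]_d) 0 i)); apply: cvgM;
    last exact: cvg_cst.
  exact: cvg_harmonic.
- apply: (@probability_integrable_bounded _ _ _ (P \x unit_uniform R)%E
    (cst 2) 2) => //.
  by move=> z; rewrite ger0_norm.
- by apply: aeW => /= z n _; rewrite lee_fin; exact: cos_defect_abs.
rewrite integral0 => /fine_cvg; exact.
Unshelve. all: by end_near. Qed.

(** After exchanging the integrals, the inner one converges for each [t] by
    hypothesis and is bounded by 2. *)
Lemma tail_mass_cvg (R : realType) (d : nat)
    (mu_ : nat -> probability (borelRd R d) R)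
    (mu : probability (borelRd R d) R) (a : R) (i : 'I_d) :
  (forall t, \int[mu_ n]_x cos (dotprod t x) @[n --> \oo] -->
    \int[mu]_x cos (dotprod t x)) ->
  tail_mass (mu_ n) a i @[n --> \oo] --> tail_mass mu a i.
Proof.
move=> hcos.
have icos (P : probability (borelRd R d) R) t :
    P.-integrable setT (EFin \o (fun x : borelRd R d => cos (dotprod t x))).
  apply: (@probability_integrable_bounded _ _ _ _ _ 1).
    apply: measurable_continuous_borelRd.
    exact/trig_poly_continuous/trig_cos.
  by move=> x; exact: cos_max.
have i1 (P : probability (borelRd R d) R) : P.-integrable setT (EFin \o cst 1).
  exact: finite_measure_integrable_cst.
have split (P : probability (borelRd R d) R) t :
    \int[P]_x (1 - cos (dotprod t x)) = 1 - \int[P]_x cos (dotprod t x).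
  rewrite RintegralB//; [|exact: i1|exact: icos].
  by congr (_ - _); exact: Rintegral_probability_cst.
pose g (P : probability (borelRd R d) R) t :=
  \int[P]_x (1 - cos (dotprod ((t * a) *: delta_mx 0 i) x)).
have gabs P t : `|g P t| <= 2.
  apply: normr_Rintegral_le; last by move=> x; exact: cos_defect_abs.
  apply: measurable_funB => //; apply: measurable_continuous_borelRd.
  exact/trig_poly_continuous/trig_cos.
have [|||||_ _ +] := @dominated_convergence _ _ _ (unit_uniform R) setT
  measurableT (fun n => EFin \o g (mu_ n)) (EFin \o g mu) (cst 2%:E).
- by move=> n; apply/measurable_EFinP; exact: measurable_cos_integral.
- by apply/measurable_EFinP; exact: measurable_cos_integral.
- apply: aeW => /= t _; apply: cvg_EFin; first by near=> n.
  rewrite /g; under eq_cvg do rewrite /= split.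
  by rewrite split; apply: cvgB; [exact: cvg_cst|exact: hcos].
- exact: (finite_measure_integrable_cst (unit_uniform R) 2).
- by apply: aeW => /= z n _; rewrite lee_fin; exact: gabs.
rewrite -tail_mass_char => /fine_cvg.
apply: cvg_trans; apply: near_eq_cvg; near=> n => /=.
by rewrite -tail_mass_char.
Unshelve. all: by end_near. Qed.

(** * From integrals of cosines and sines to weak convergence *)

Lemma Rintegral_sum dT (T : measurableType dT) (R : realType)
    (P : probability T R) (I : Type) (r : seq I) (F : I -> T -> R) :
  (forall i, P.-integrable setT (EFin \o F i)) ->
  P.-integrable setT (EFin \o (fun x => \sum_(i <- r) F i x)) /\
  \int[P]_x (\sum_(i <- r) F i x) = \sum_(i <- r) \int[P]_x F i x.
Proof.
move=> iF; elim: r => [|i r [iS IH]].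
  have -> : (fun x => \sum_(i <- [::]) F i x) = cst 0.
    by apply/funext => x; rewrite big_nil.
  split; first exact: finite_measure_integrable_cst.
  by rewrite big_nil; exact: Rintegral_probability_cst.
have -> : (fun x => \sum_(j <- i :: r) F j x) =
    (fun x => F i x + \sum_(j <- r) F j x).
  by apply/funext => x; rewrite big_cons.
split; first exact: integrableD (iF i) iS.
by rewrite RintegralD// IH big_cons.
Qed.

Definition total_tail_mass (R : realType) (d : nat)
    (P : probability (borelRd R d) R) (a : R) : R :=
  \sum_(i < d) tail_mass P a i.

(** On the box the integrand is at most [e]. Off the box some [sinc_defect] is at
    least 1/2, and its coefficient [4 B] then pays for [|f| + |T| <= 2 B]. *)
Lemma integral_approx (R : realType) (d : nat) (P : probability (borelRd R d) R)
    (f T : 'rV[R]_d -> R) (B e a : R) :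
  continuous f -> continuous T -> 0 < a -> 0 <= e ->
  (forall x, `|f x| <= B) -> (forall x, `|T x| <= B) ->
  (forall x : 'rV[R]_d, (forall i, `|x 0 i| <= 2 / a) -> `|T x - f x| <= e) ->
  `|\int[P]_x f x - \int[P]_x T x| <= e + 4 * B * total_tail_mass P a.
Proof.
move=> cf cT a0 e0 fB TB fT.
have B0 : 0 <= B by exact: le_trans (normr_ge0 _) (fB 0).
pose S (i : 'I_d) (x : borelRd R d) :=
  4 * B * sinc_defect (a * (x : 'rV[R]_d) 0 i).
have is_ i : P.-integrable setT
    (EFin \o (fun x : borelRd R d => sinc_defect (a * (x : 'rV[R]_d) 0 i))).
  apply: (@probability_integrable_bounded _ _ _ _ _ 2).
    exact: measurable_sinc_defect_coord.
  move=> x; apply: normr_Rintegral_le; first exact: measurable_cos_scale.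
  by move=> t; exact: cos_defect_abs.
have ie : P.-integrable setT (EFin \o cst e).
  exact: finite_measure_integrable_cst.
have iS i : P.-integrable setT (EFin \o S i).
  exact: (integrableZl measurableT (4 * B) (is_ i)).
have [iSS SSE] := Rintegral_sum (index_enum 'I_d) iS.
have ib (g : 'rV[R]_d -> R) : continuous g -> (forall x, `|g x| <= B) ->
    P.-integrable setT (EFin \o (g : borelRd R d -> R)).
  move=> cg gB.
  apply: (@probability_integrable_bounded _ _ _ P (g : borelRd R d -> R) B) => //.
  exact: measurable_continuous_borelRd.
have ifT : P.-integrable setT (EFin \o (fun x : borelRd R d => f x - T x)).
  exact: integrableB (ib _ cf fB) (ib _ cT TB).
rewrite -RintegralB//; [|exact: ib|exact: ib].
apply: le_trans (le_normr_Rintegral _ _) _ => //.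
have -> : e + 4 * B * total_tail_mass P a =
    \int[P]_x (e + \sum_(i < d) S i x).
  rewrite RintegralD//.
  congr (_ + _); first by rewrite Rintegral_probability_cst.
  rewrite SSE mulr_sumr; apply: eq_bigr => i _.
  by rewrite RintegralZl// tail_mass_sinc.
apply: le_Rintegral => //.
- exact: integrable_norm.
- exact: integrableD ie iSS.
move=> x _; have S0 i : 0 <= S i x.
  by rewrite mulr_ge0 ?sinc_defect_ge0// mulr_ge0.
have [xin|] := pselect (forall i, `|(x : 'rV[R]_d) 0 i| <= 2 / a).
  by rewrite distrC -[leLHS]addr0 lerD ?fT// sumr_ge0.
move=> /existsNP[i /negP]; rewrite -ltNge => /ltW xi.
have : 2 * B <= S i x.
  have -> : 2 * B = 4 * B * 2^-1 by field.
  rewrite ler_wpM2l ?mulr_ge0// sinc_defect_ge_half//.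
  by rewrite normrM (gtr0_norm a0) mulrC -ler_pdivrMr.
rewrite (bigD1 i)//=.
have : 0 <= \sum_(j < d | j != i) S j x by rewrite sumr_ge0.
have := ler_normB (f x) (T x); have := fB x; have := TB x; lra.
Qed.

Lemma trig_poly_integral_cvg (R : realType) (d : nat)
    (mu_ : nat -> probability (borelRd R d) R)
    (mu : probability (borelRd R d) R) (T : 'rV[R]_d -> R) :
  (forall t, \int[mu_ n]_x cos (dotprod t x) @[n --> \oo] -->
    \int[mu]_x cos (dotprod t x)) ->
  (forall t, \int[mu_ n]_x sin (dotprod t x) @[n --> \oo] -->
    \int[mu]_x sin (dotprod t x)) ->
  trig_poly T -> \int[mu_ n]_x T x @[n --> \oo] --> \int[mu]_x T x.
Proof.
move=> hcos hsin.
have ib (P : probability (borelRd R d) R) (g : 'rV[R]_d -> R) :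
    trig_poly g -> P.-integrable setT (EFin \o (g : borelRd R d -> R)).
  move=> tg; have [B gB] := trig_poly_bounded tg.
  apply: (@probability_integrable_bounded _ _ _ P (g : borelRd R d -> R) B) => //.
  by apply: measurable_continuous_borelRd; exact: trig_poly_continuous.
elim=> {T} [t|t|f g tf cf tg cg|a f tf cf]; [exact: hcos|exact: hsin| |].
- have intD (P : probability (borelRd R d) R) :
      \int[P]_x (f x + g x) = \int[P]_x f x + \int[P]_x g x.
    by apply: RintegralD => //; exact: ib.
  by under eq_fun do rewrite intD; rewrite intD; exact: cvgD.
- have intZ (P : probability (borelRd R d) R) :
      \int[P]_x (a * f x) = a * \int[P]_x f x.
    by apply: RintegralZl => //; exact: ib.
  by under eq_fun do rewrite intZ; rewrite intZ; apply: cvgM; [exact: cvg_cst|].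
Qed.

Lemma cos_sin_cvg_weak (R : realType) (d : nat)
    (mu_ : nat -> probability (borelRd R d) R)
    (mu : probability (borelRd R d) R) :
  (forall t, \int[mu_ n]_x cos (dotprod t x) @[n --> \oo] -->
    \int[mu]_x cos (dotprod t x)) ->
  (forall t, \int[mu_ n]_x sin (dotprod t x) @[n --> \oo] -->
    \int[mu]_x sin (dotprod t x)) ->
  weakly_converges mu_ mu.
Proof.
move=> hcos hsin f cf [M [_ fM]].
have {fM} [B fB] : exists B, forall x, `|f x| <= B.
  by exists (M + 1) => x; apply: fM => //; rewrite ltrDl.
apply/cvgrPdist_lt => e e0; have e60 : 0 < e / 6 by rewrite divr_gt0.
have tail_k : 4 * B * total_tail_mass mu k.+1%:R^-1 @[k --> \oo] --> (0 : R).
  rewrite -[X in _ --> X](mulr0 (4 * B)); apply: cvgM; first exact: cvg_cst.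
  rewrite (_ : 0 = \sum_(i < d) (0 : R)); last by rewrite big1.
  apply: cvg_big => [|i _]; first exact: add_continuous.
  exact: tail_mass_scale_cvg0.
have [k tk] : exists k, 4 * B * total_tail_mass mu k.+1%:R^-1 < e / 6.
  have /cvgrPdist_lt/(_ _ e60)[k _ hk] := tail_k.
  exists k; have := hk k (leqnn k); rewrite /= sub0r normrN.
  by move/ltr_normlW.
have a0 : 0 < k.+1%:R^-1 :> R by rewrite invr_gt0.
set a : R := k.+1%:R^-1 in tk a0.
have tail_n : 4 * B * total_tail_mass (mu_ n) a @[n --> \oo] -->
    4 * B * total_tail_mass mu a.
  apply: cvgM; first exact: cvg_cst.
  apply: cvg_big => [|i _]; first exact: add_continuous.
  exact: tail_mass_cvg.
have L0 : 0 < 2 / a by rewrite divr_gt0.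
have [T [tT TB fT]] := trig_poly_approx cf fB e60 L0.
have cT := trig_poly_continuous tT.
have approx P := integral_approx P cf cT a0 (ltW e60) fB TB fT.
have T_n := trig_poly_integral_cvg hcos hsin tT.
near=> n.
have : `|\int[mu]_x T x - \int[mu_ n]_x T x| < e / 6.
  by near: n; move/cvgrPdist_lt : T_n; exact.
have : 4 * B * total_tail_mass (mu_ n) a < e / 6.
  by near: n; apply: (cvgr_lt _ tail_n).
have := approx mu; have := approx (mu_ n).
rewrite !ler_norml !ltr_norml => *; lra.
Unshelve. all: by end_near. Qed.

Lemma char_funE (R : realType) (d : nat) (P : probability (borelRd R d) R)
    (t : 'rV[R]_d) :
  char_fun P t =
  Complex (\int[P]_x cos (dotprod t x)) (\int[P]_x sin (dotprod t x)).
Proof.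
rewrite /char_fun /Cintegral; congr Complex; apply: eq_Rintegral => x _;
  by rewrite /expC/= !(mul0r, mul1r, mulr0, oppr0, subr0, addr0, add0r, expR0).
Qed.

Lemma normc_ge_Im (R : realType) (z : R[i]) : (`|complex.Im z|%:C <= `|z|)%C.
Proof.
by rewrite normc_def lecR -sqrtr_sqr ler_wsqrtr// lerDr sqr_ge0.
Qed.

Lemma cvg_complexP (R : realType) (u v : nat -> R) (a b : R) :
  ((Complex (u n) (v n) : R[i]^o) @[n --> \oo] --> (Complex a b : R[i]^o)) <->
  (u n @[n --> \oo] --> a) /\ (v n @[n --> \oo] --> b).
Proof.
split=> [h|[hu hv]].
  split; apply/cvgrPdist_lt => e e0.
    have e0' : (0 < e%:C)%C by rewrite ltcR.
    move/cvgrPdist_lt : h => /(_ _ e0'); apply: filterS => n.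
    by move=> /(le_lt_trans (normc_ge_Re _)); rewrite ltcR.
  have e0' : (0 < e%:C)%C by rewrite ltcR.
  move/cvgrPdist_lt : h => /(_ _ e0'); apply: filterS => n.
  by move=> /(le_lt_trans (normc_ge_Im _)); rewrite ltcR.
apply/cvgrPdist_lt => /= -[e e'] /=; rewrite ltcE/= => /andP[/eqP -> e0].
have e20 : 0 < e / 2 by rewrite divr_gt0.
near=> n.
have un : `|a - u n| < e / 2 by near: n; move/cvgrPdist_lt : hu; exact.
have vn : `|b - v n| < e / 2 by near: n; move/cvgrPdist_lt : hv; exact.
rewrite -[Complex e 0]/(e%:C)%C normc_def ltcR/=.
have e_sqr : e = Num.sqrt (e ^+ 2) by rewrite sqrtr_sqr gtr0_norm.
rewrite [ltRHS]e_sqr ltr_sqrt ?exprn_gt0//.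
rewrite -(real_normK (num_real (a - u n))) -(real_normK (num_real (b - v n))).
have := normr_ge0 (a - u n); have := normr_ge0 (b - v n); nra.
Unshelve. all: by end_near. Qed.

Theorem theorem1p1 (R : realType) (d : nat) (hd : (1 <= d)%N)
    (mu : probability (borelRd R d) R)
    (mu_ : nat -> probability (borelRd R d) R) :
  weakly_converges mu_ mu <->
  (forall t : 'rV[R]_d, char_fun (mu_ n) t @[n --> \oo] --> char_fun mu t).
Proof.
have charP t : char_fun (mu_ n) t @[n --> \oo] --> char_fun mu t <->
    (\int[mu_ n]_x cos (dotprod t x) @[n --> \oo] -->
       \int[mu]_x cos (dotprod t x)) /\
    (\int[mu_ n]_x sin (dotprod t x) @[n --> \oo] -->
       \int[mu]_x sin (dotprod t x)).
  rewrite -cvg_complexP char_funE.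
  by under eq_cvg do rewrite char_funE.
have bounded_trig (f : 'rV[R]_d -> R) : trig_poly f -> bounded_fun f.
  move=> /trig_poly_bounded[B fB]; exists B; split; first by rewrite num_real.
  by move=> M BM x _ /=; exact: le_trans (fB x) (ltW BM).
split=> [w t|h].
  apply/charP; split; apply: w.
  - exact/trig_poly_continuous/trig_cos.
  - exact/bounded_trig/trig_cos.
  - exact/trig_poly_continuous/trig_sin.
  - exact/bounded_trig/trig_sin.
by apply: cos_sin_cvg_weak => t; have /charP[] := h t.
Qed.
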